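(* Let $(a(n))_{n\in\mathbb{N}}$ be a sequence of integers such that $(a(n+1)-a(n))_{n\in\mathbb{N}}$ is uniformly bounded. Then for (Lebesgue-)almost all real numbers $x$, the sequences $a_x(n):=a(n)x \bmod 1$ have the same entropy; that is, there is $\lambda\in[0,\infty]$ such that $\mathrm{AE}(a_x)=\lambda$ for almost every $x\in\mathbb{R}$.
   Context: $\mathbb{N}=\{0,1,2,\dots\}$; $a(n)x\bmod 1$ is regarded as an element of $\mathbb{R}/\mathbb{Z}$. Entropy of a sequence: let $x=(x(n))_{n\in\mathbb{N}}$ be a sequence in $K=\mathbb{R}/\mathbb{Z}$, or a bounded sequence in $K=\mathbb{C}$. Let $X_0$ be the closure of $\{x(n):n\in\mathbb{N}\}$ in $K$ (a compact space), and let $X_x$ be the closure of $\{(x(m),x(m+1),x(m+2),\dots): m\in\mathbb{N}\}$ in $X_0^{\mathbb{N}}$ with the product topology. The shift $\sigma:(\omega_0,\omega_1,\dots)\mapsto(\omega_1,\omega_2,\dots)$ maps $X_x$ continuously to itself. The (anqie) entropy of $x$, denoted $\mathrm{AE}(x)\in[0,\infty]$, is the topological entropy of $(X_x,\sigma)$: the supremum over open covers $\mathcal{U}$ of $X_x$ of $\lim_{n}\frac1n\log\mathcal{N}(\mathcal{U}\vee\sigma^{-1}\mathcal{U}\vee\cdots\vee\sigma^{-n+1}\mathcal{U})$, where $\mathcal{N}(\mathcal{W})$ is the minimal cardinality of a subcover of $\mathcal{W}$. *)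

(* Defs.v *)
From HB Require Import structures.
From mathcomp Require Import all_boot all_order all_algebra generic_quotient.
From mathcomp Require Import all_classical all_reals all_analysis.

Set Implicit Arguments.
Unset Strict Implicit.
Unset Printing Implicit Defensive.

Import Order.TTheory GRing.Theory Num.Theory.
Import numFieldNormedType.Exports.

Local Open Scope classical_set_scope.
Local Open Scope ring_scope.
Local Open Scope quotient_scope.

Section circle.
Variable R : realType.

Definition congZ (x y : R) : bool := (x - y) \is a Num.int.

Lemma congZ_refl : reflexive congZ.
Proof. by move=> x; rewrite /congZ subrr rpred0. Qed.

Lemma congZ_sym : symmetric congZ.
Proof. by move=> x y; rewrite /congZ -rpredN opprB. Qed.

Lemma congZ_trans : transitive congZ.
Proof.
move=> y x z; rewrite /congZ => xy yz.
by rewrite -(subrK y x) -addrA rpredD.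
Qed.

Canonical congZ_equiv := EquivRel congZ congZ_refl congZ_sym congZ_trans.

Definition RmodZ : ptopologicalType := quotient_topology {eq_quot congZ}.

Definition mod1 (x : R) : RmodZ := \pi_RmodZ x.

End circle.

Section topological_entropy.
Variable R : realType.
Variables (T : topologicalType) (f : T -> T).
Implicit Types U V W : set (set T).

Definition is_cover W := \bigcup_(A in W) A = [set: T].

Definition open_cover U := (forall A, U A -> open A) /\ is_cover U.

Definition cover_join U V := [set A `&` B | A in U & B in V].

Definition cover_preimage (n : nat) U := [set iter n f @^-1` A | A in U].

(* [set setT] is neutral for cover_join *)
Definition cover_iter U (n : nat) : set (set T) :=
  \big[cover_join/[set setT]]_(i < n) cover_preimage i U.

(* the infimum is attained; it is +oo when W has no finite subcover *)
Definition min_card_subcover W : \bar R :=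
  ereal_inf [set n%:R%:E | n in
    [set n : nat | exists V, [/\ V `<=` W, is_cover V & (V #= `I_n)%card]]].

(* for T compact and nonempty the limit exists by subadditivity, so the default
   value of limn is irrelevant *)
Definition cover_entropy U : \bar R :=
  limn (fun n : nat =>
    ((n%:R^-1)%:E * lne (min_card_subcover (cover_iter U n)))%E).

Definition topological_entropy : \bar R :=
  ereal_sup [set cover_entropy U | U in open_cover].

End topological_entropy.

Section sequence_entropy.
Variable R : realType.
Variables (K : topologicalType) (x : nat -> K).

Definition range_closure : set K := closure (range x).

Lemma range_closureP n : x n \in range_closure.
Proof. by rewrite inE; apply: subset_closure; exists n. Qed.

Definition seq_in_closure (n : nat) : range_closure :=
  exist _ (x n) (range_closureP n).

Definition sequence_space : topologicalType := {ptws nat -> range_closure}.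

Definition seq_shift (w : sequence_space) : sequence_space := fun n => w n.+1.

Definition orbit (m : nat) : sequence_space :=
  fun n => seq_in_closure (m + n)%N.

Definition orbit_closure : set sequence_space := closure (range orbit).

Lemma shift_continuous : continuous seq_shift.
Proof.
move=> w; apply/cvg_sup; first exact/fmap_filter/nbhs_filter.
move=> n A.
have /= -> := @nbhsE
  (initial_topology (fun f : nat -> range_closure => f n)) (seq_shift w).
move=> -[_ [[C oC <-] Cw]] /filterS; apply; first exact/fmap_filter/nbhs_filter.
have := @proj_continuous _ (fun=> range_closure) n.+1 w C.
by move=> H; apply: H; apply: open_nbhs_nbhs.
Qed.

Lemma shift_orbit_closure w : orbit_closure w -> orbit_closure (seq_shift w).
Proof.
move=> Xw A nA.
have [_ [[m _ <-] Am]] := Xw _ (shift_continuous nA).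
exists (seq_shift (orbit m)); split=> //; exists m.+1 => //.
by apply/funext => n; rewrite /seq_shift /orbit addSnnS.
Qed.

Lemma shift_orbit_closure_in (w : orbit_closure) :
  seq_shift (val w) \in orbit_closure.
Proof. by rewrite inE; apply/shift_orbit_closure/set_mem/valP. Qed.

Definition shift_on_orbit_closure (w : orbit_closure) : orbit_closure :=
  exist _ (seq_shift (val w)) (shift_orbit_closure_in w).

Definition AE : \bar R := topological_entropy R shift_on_orbit_closure.

End sequence_entropy.

(* Main.v *)
Require Import Defs.
From HB Require Import structures.
From mathcomp Require Import all_boot all_order all_algebra generic_quotient.
From mathcomp Require Import all_classical all_reals all_analysis.
From mathcomp Require Import ring lra zify.

Set Implicit Arguments.
Unset Strict Implicit.
Unset Printing Implicit Defensive.

Import Order.TTheory GRing.Theory Num.Theory.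
Import numFieldNormedType.Exports.

Local Open Scope classical_set_scope.
Local Open Scope ring_scope.

(* The entropy is the same for every irrational x: it is the exponential growth
   rate h of the number p(n) of words of length n occurring in the sequence of
   differences s(n) = a(n+1) - a(n), which has a finite alphabet.

   Lower bound: for irrational x the relation w_1 = w_0 + k x determines the
   integer k, so the sets where it holds form a finite clopen partition, whose
   n-th iterated join separates orbit points with different words of length n.

   Upper bound: two points of the orbit closure following the same word differ
   by a rotation of the circle, hence stay at a constant distance.  By
   compactness, an open cover is refined by the sets of points that follow a
   given word of some fixed length N and start in a given arc of length about
   1/N; cutting the circle into N + 2 arcs therefore covers the n-th iterated
   join by at most (N + 2) p(n + N) <= (N + 2) p(N) p(n) sets. *)

(** * Lifts, topology and rotations of the circle *)

Section circle.
Local Open Scope quotient_scope.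
Variable R : realType.
Implicit Types (s t e : R) (z : RmodZ R).

Lemma mod1_eqP s t : mod1 s = mod1 t <-> s - t \is a Num.int.
Proof.
have congE : (\pi_({eq_quot @congZ R}) s == \pi_({eq_quot @congZ R}) t) =
    (s - t \is a Num.int) by rewrite eqmodE.
by rewrite -congE; exact: (rwP (@eqP {eq_quot @congZ R} _ _)).
Qed.

Lemma mod1_surj z : exists t, z = mod1 t.
Proof. by exists (repr z); rewrite /mod1 reprK. Qed.

Lemma mod1_addz t (k : int) : mod1 (t + k%:~R) = mod1 t.
Proof. by apply/mod1_eqP; rewrite addrAC subrr add0r rpred_int. Qed.

Lemma mod1_lift01 z : exists2 t, 0 <= t < 1 & z = mod1 t.
Proof.
have [t ->] := mod1_surj z.
exists (t - (Num.floor t)%:~R); last by rewrite -intrN mod1_addz.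
have /andP[] := floor_itv t; rewrite intrD.
by move=> *; apply/andP; split; lra.
Qed.

Lemma mod1_continuous : continuous (@mod1 R).
Proof. exact: pi_continuous. Qed.

(** The quotient map is open: the preimage of the image of an open set is the union of its integer
    translates. Neighbourhoods on the circle can thus be tested on any lift. *)
Lemma nbhs_mod1 t (A : set (RmodZ R)) :
  nbhs (mod1 t) A <-> \forall s \near t, A (mod1 s).
Proof.
split=> [/(@mod1_continuous t) //|tA].
pose O := [set s | A (mod1 s)]°%classic.
rewrite nbhsE; exists (@mod1 R @` O); last first.
  by move=> _ [s Os <-]; exact: interior_subset Os.
split; last by exists t.
suff : open (@mod1 R @^-1` (@mod1 R @` O)) by [].
rewrite openE => s [s' Os' /mod1_eqP/intrP[k kE]].
have cs : (fun r => r + k%:~R) r @[r --> s] --> s'.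
  have -> : s' = s + k%:~R by rewrite -kE addrC subrK.
  by apply: cvgD; [exact: cvg_id|exact: cvg_cst].
have /cs sO : nbhs s' O.
  by apply: open_nbhs_nbhs; split => //; exact: open_interior.
by apply: (@filterS _ (nbhs s) _ _ _ _ sO) => r Or;
  exists (r + k%:~R) => //; rewrite mod1_addz.
Qed.

(** [RmodZ] is only a topological space here, so rotation by a real angle stands in for addition.
    The choice of representative is harmless by [circle_rot_mod1]. *)
Definition circle_rot e z : RmodZ R := mod1 (repr z + e).

Lemma circle_rot_mod1 e t : circle_rot e (mod1 t) = mod1 (t + e).
Proof.
apply/mod1_eqP; rewrite opprD addrACA subrr addr0; apply/mod1_eqP.
by rewrite /mod1 reprK.
Qed.

Lemma circle_rot0 z : circle_rot 0 z = z.
Proof. by have [t ->] := mod1_surj z; rewrite circle_rot_mod1 addr0. Qed.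

Lemma circle_rot_eqP d e z :
  circle_rot d z = circle_rot e z <-> d - e \is a Num.int.
Proof.
have [t ->] := mod1_surj z; rewrite !circle_rot_mod1.
by apply: iff_trans (mod1_eqP _ _) _; rewrite opprD addrACA subrr add0r.
Qed.

(** Joint continuity is what lets [nbhs_rotation] vary the point and the angle at once. *)
Lemma circle_rot_continuous2 (z : RmodZ R) e :
  (fun p : RmodZ R * R => circle_rot p.2 p.1) p @[p --> (z, e)] -->
    circle_rot e z.
Proof.
have [t ->] := mod1_surj z; rewrite circle_rot_mod1 => A /nbhs_mod1 tA.
have cD : (fun p : R * R => p.1 + p.2) p @[p --> (t, e)] --> t + e.
  by apply: cvgD; [exact: cvg_fst|exact: cvg_snd].
have [[P Q] /= [tP eQ] PQ] := cD _ tA.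
exists (@mod1 R @` P, Q) => /=.
  split=> //; apply/nbhs_mod1; apply: filterS tP => s Ps.
  by exists s.
move=> [_ d] /= [[s Ps <-] Qd].
by rewrite circle_rot_mod1; apply: (PQ (s, d)).
Qed.

Lemma circle_rot_continuous e : continuous (circle_rot e).
Proof.
move=> z A /circle_rot_continuous2 [[P Q] /= [zP eQ] PQ].
apply: filterS zP => y Py; apply: (PQ (y, e)); split => //.
exact: nbhs_singleton eQ.
Qed.

Lemma RmodZ_hausdorff : hausdorff_space (RmodZ R).
Proof.
move=> y z; have [t ->] := mod1_surj z; have [s ->] := mod1_surj y => st.
apply: contrapT => /mod1_eqP sNt.
pose k := Num.floor (s - t).
have /andP[ks sk] := floor_itv (s - t).
rewrite intrD -/k -[1%:~R]/(1 : R) in ks sk.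
have {}ks : k%:~R < s - t.
  rewrite lt_neqAle ks andbT; apply/eqP => E; apply: sNt.
  by rewrite -E rpred_int.
(* As [s - t] lies strictly between [k] and [k + 1], arcs of small enough radius [e] around [s] and
   [t] have no lifts that differ by an integer. *)
have [e e0 [e1 e2]] : exists2 e : R, 0 < e &
    k%:~R + e * 2 < s - t /\ s - t + e * 2 < k%:~R + 1.
  pose m := Num.min (s - t - k%:~R) (k%:~R + 1 - (s - t)).
  have m1 : m <= s - t - k%:~R by rewrite ge_min lexx.
  have m2 : m <= k%:~R + 1 - (s - t) by rewrite ge_min lexx orbT.
  have m0 : 0 < m by rewrite lt_min; apply/andP; split; lra.
  by exists (m / 4); lra.
have arc r : nbhs (mod1 r) [set w | exists2 r', `|r' - r| < e & w = mod1 r'].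
  apply/nbhs_mod1; apply: filterS (nbhsx_ballx r e e0) => r' rr'.
  by exists r' => //; rewrite distrC.
have [w [[s' + wE] [t' + wE']]] := st _ _ (arc s) (arc t).
have /mod1_eqP/intrP[j jE] : mod1 s' = mod1 t' by rewrite -wE.
rewrite !ltr_norml => /andP[? ?] /andP[? ?].
have : k%:~R < j%:~R :> R by lra.
have : j%:~R < (k + 1)%:~R :> R by rewrite intrD; lra.
by rewrite !ltr_int; lia.
Qed.

Lemma RmodZ_compact : compact [set: RmodZ R].
Proof.
have -> : [set: RmodZ R] = @mod1 R @` `[0, 1]%classic.
  apply/seteqP; split => // z _; have [t /andP[t0 t1] ->] := mod1_lift01 z.
  by exists t => //=; rewrite in_itv/= t0 ltW.
apply: continuous_compact; last exact: segment_compact.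
by apply: continuous_subspaceT; exact: mod1_continuous.
Qed.

End circle.

(** * Initial topologies, closed subspaces and coincidence sets *)

Lemma cvg_initial_topology (S : choiceType) (T : topologicalType) (f : S -> T)
    (F : set_system S) (s : S) : Filter F ->
  f @ F --> f s -> F --> (s : initial_topology f).
Proof.
move=> FF Ffs A; rewrite nbhsE => -[_ [[B oB <-] Bs] BA].
by apply: filterS BA _; apply: Ffs; exact: open_nbhs_nbhs.
Qed.

Lemma closed_set_type_compact (T : topologicalType) (A : set T) :
  compact [set: T] -> closed A -> compact [set: A].
Proof.
move=> cT cA F FF _.
have [p [_ clp]] := cT (val @ F) _ filterT.
have Ap : A p.
  apply: cA => B /(clp A); apply.
  by apply: (@filterS _ F _ setT) filterT => a _; exact: set_valP.
exists (exist _ p (mem_set Ap)); split=> // B C FB.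
rewrite nbhsE => -[_ [[D oD <-] Dp] DC].
have FB' : (val @ F) ((val : A -> T) @` B).
  by apply: (@filterS _ F _ B) FB => b Bb; exists b.
have [_ [[b Bb <-] Db]] : ((val : A -> T) @` B) `&` D !=set0.
  by apply: clp FB' _; exact: open_nbhs_nbhs.
by exists b; split => //; exact: DC.
Qed.

Lemma closed_eq_fun (S T : topologicalType) (f g : S -> T) :
  hausdorff_space T -> continuous f -> continuous g ->
  closed [set s | f s = g s].
Proof.
move=> hT cf cg s sfg; apply: hT => A B fA gB.
have fgAB : nbhs s (f @^-1` A `&` g @^-1` B).
  by apply: filterI; [exact: cf|exact: cg].
have [r [/= -> [/= Ar Br]]] := sfg _ fgAB.
by exists (g r).
Qed.

(** * The orbit closure and its coordinates *)

Section orbit_closure.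
Variables (K : topologicalType) (x : nat -> K).
Local Notation X := (set_type (@orbit_closure K x)).
Implicit Type w : X.

Definition orbit_coord (n : nat) w : K := val (val w n).

Lemma orbit_coord_shift n w :
  orbit_coord n (shift_on_orbit_closure w) = orbit_coord n.+1 w.
Proof. by []. Qed.

Lemma orbit_coord_iter_shift i n w :
  orbit_coord n (iter i (@shift_on_orbit_closure K x) w) =
    orbit_coord (n + i) w.
Proof.
by elim: i n => [n|i IH n]; rewrite ?addn0//= orbit_coord_shift IH addSnnS.
Qed.

Lemma orbit_coord_continuous n : continuous (orbit_coord n).
Proof.
move=> w A nA.
have nA1 : nbhs (val w n) ((val : range_closure x -> K) @^-1` A).
  exact: (@initial_continuous (range_closure x) K val (val w n) A nA).
have nA2 := @proj_continuous _ (fun=> range_closure x) n (val w) _ nA1.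
exact: (@initial_continuous X (sequence_space x) val w _ nA2).
Qed.

Lemma cvg_coord (F : set_system X) w : Filter F ->
  (forall n, orbit_coord n @ F --> orbit_coord n w) -> F --> w.
Proof.
(* The topology has three layers: a subspace of the sequences, a product, and a subspace of [K]. *)
move=> FF Fw; apply: cvg_initial_topology; apply/cvg_sup => n.
apply: cvg_initial_topology; apply: cvg_initial_topology.
exact: Fw.
Qed.

Lemma orbit_in_closure m : Defs.orbit x m \in @orbit_closure K x.
Proof. by rewrite inE; apply: subset_closure; exists m. Qed.

Definition orbit_point m : X := exist _ (Defs.orbit x m) (orbit_in_closure m).

Lemma orbit_coord_orbit_point m n : orbit_coord n (orbit_point m) = x (m + n)%N.
Proof. by []. Qed.

(** Relations that hold along the sequence pass to all limit points in this way, once they are known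
    to be closed conditions. *)
Lemma orbit_point_dense (A : set X) :
  closed A -> (forall m, A (orbit_point m)) -> A = [set: X].
Proof.
move=> cA Aorb; apply/seteqP; split=> // w _; apply: cA => B.
rewrite nbhsE => -[_ [[C oC <-] Cw] CB].
have [_ [[m _ <-] Cm]] : (range (Defs.orbit x) `&` C) !=set0.
  by apply: (set_mem (valP w)); exact: open_nbhs_nbhs.
by exists (orbit_point m); split; [exact: Aorb|exact: CB].
Qed.

Lemma orbit_closure_compact : compact [set: K] -> compact [set: X].
Proof.
move=> cK; apply: closed_set_type_compact; last exact: closed_closure.
have cR : compact [set: range_closure x].
  by apply: closed_set_type_compact => //; exact: closed_closure.
have -> : [set: sequence_space x] =
    [set f : sequence_space x | forall i, [set: range_closure x] (f i)].
  by apply/seteqP; split.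
exact: (@tychonoff _ (fun=> range_closure x) (fun=> setT)) (fun=> cR).
Qed.

End orbit_closure.

(** * Iterated joins and minimal subcovers *)

Section covers.
Variables (T : topologicalType) (f : T -> T).
Implicit Types (U V : set (set T)) (B : set T).

Lemma cover_iter_sub U n B i : cover_iter f U n B -> (i < n)%N ->
  exists2 A, U A & B `<=` iter i f @^-1` A.
Proof.
move=> + ltin; rewrite /cover_iter.
have : Ordinal ltin \in index_enum 'I_n by rewrite mem_index_enum.
elim: (index_enum _) B => // j s IH B; rewrite inE big_cons.
move=> + [_ [A UA <-] [D /IH{}IH <-]] => /orP[/eqP<-|/IH[A' UA' DA']].
  by exists A => // y [].
by exists A' => // y [_ /DA'].
Qed.

(** A member of the join amounts to a choice of one set of the cover for each time; this and
    [cover_iter_sub] are all that is used about [cover_iter]. *)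
Lemma cover_iter_sup U n (A : nat -> set T) : (forall i, U (A i)) ->
  exists2 B, cover_iter f U n B &
    forall y, (forall i, (i < n)%N -> A i (iter i f y)) -> B y.
Proof.
move=> UA; rewrite /cover_iter.
have [B UB BA] : exists2 B,
    (\big[@cover_join T/[set setT]]_(i < n) cover_preimage f i U) B &
    forall y, (forall i : 'I_n, A i (iter i f y)) -> B y.
  elim: (index_enum _) => [|j s [B UB BA]].
    by rewrite big_nil; exists setT.
  rewrite big_cons; exists (iter j f @^-1` A j `&` B).
    by exists (iter j f @^-1` A j); [exists (A j)|exists B].
  by move=> y Ay; split; [exact: Ay|exact: BA].
by exists B => // y Ay; apply: BA => i; exact: Ay.
Qed.

Variable R : realType.


Lemma min_card_subcover_le V (I : finType) (g : I -> set T) :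
  (forall i, V (g i)) -> (forall y, exists i, g i y) ->
  (min_card_subcover R V <= #|I|%:R%:E)%E.
Proof.
move=> Vg gcov.
pose h k := if insub k is Some i then g (@enum_val _ I i) else set0.
have hV : range g = h @` `I_#|I|.
  apply/seteqP; split=> [_ [i _ <-]|_ [k kI <-]].
    exists (enum_rank i); first exact: ltn_ord.
    by rewrite /h valK enum_rankK.
  by rewrite /h insubT; eexists.
(* As [g] may repeat values, the subcover [range g] can have fewer than [#|I|] members; [n] is its
   exact cardinality. *)
have [n gn] : exists n, (range g #= `I_n)%card.
  by apply/finite_setP; rewrite hV; exact: finite_image.
apply: ge_ereal_inf; exists n%:R%:E.
  exists n => //; exists (range g); split => //; first by move=> _ [i _ <-].
  apply/seteqP; split => // y _; have [i giy] := gcov y.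
  by exists (g i) => //; exists i.
rewrite lee_fin ler_nat -card_le_II -(card_le_eql gn) hV.
exact: card_image_le.
Qed.

(** Sending a member of [V] to the index of the only point [o s] it may contain maps every subcover
    onto [S]. *)
Lemma min_card_subcover_ge V (S : finType) (o : S -> T) :
  (forall B s s', V B -> B (o s) -> B (o s') -> s = s') ->
  (#|S|%:R%:E <= min_card_subcover R V)%E.
Proof.
move=> Vo; apply: le_ereal_inf_tmp => _ [n [W [WV Wcov Wn]] <-].
rewrite lee_fin ler_nat -card_le_II -(card_le_eqr Wn).
pose h B :=
  if [pick s | `[< B (o s) >]] is Some s then enum_rank s : nat else 0.
apply: card_le_trans (card_image_le h W).
apply: subset_card_le => k kS; pose s := enum_val (Ordinal kS).
have [B WB Bs] : (\bigcup_(B in W) B) (o s) by rewrite [X in X _]Wcov.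
exists B => //; rewrite /h; case: pickP => [s' /asboolP Bs'|/(_ s)/asboolP//].
by rewrite (Vo _ _ _ (WV _ WB) Bs' Bs) enum_valK.
Qed.

End covers.

(** * Fekete's lemma for subadditive sequences *)

Lemma fekete (R : realType) (u : nat -> R) :
  (forall n, 0 <= u n) -> (forall m n, u (m + n)%N <= u m + u n) ->
  exists2 L : R, 0 <= L & (fun n => n%:R^-1 * u n) @ \oo --> L.
Proof.
move=> u0 usub; pose E := [set n.+1%:R^-1 * u n.+1 | n in [set: nat]].
have E0 : lbound E 0 by move=> _ [n _ <-]; rewrite mulr_ge0// invr_ge0.
have infE : has_inf E by split; [exists (1%:R^-1 * u 1%N); exists 0%N|exists 0].
exists (inf E); first by apply: lb_le_inf => //; case: infE.
apply/cvgrPdist_lt => /= e e0.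
have e20 : 0 < e / 2 by rewrite divr_gt0.
(* The limit is the infimum of the averages; [k.+1] is a block length whose average is within
   [e / 2] of it. *)
have [_ [k _ <-] kE] := inf_adherent e20 infE.
pose M := \sum_(r < k.+1) u r.
have M0 : 0 <= M by exact: sumr_ge0.
have uM r : (r < k.+1)%N -> u r <= M.
  move=> rk; rewrite /M (bigD1 (Ordinal rk))//= lerDl.
  by apply: sumr_ge0.
(* An index is cut into [q] blocks of length [k.+1] and a remainder, whose contribution is at most
   the constant [M]. *)
have uq q r : (r < k.+1)%N -> u (q * k.+1 + r)%N <= q%:R * u k.+1 + M.
  move=> rk; elim: q => [|q IH]; first by rewrite mul0r add0r mul0n uM.
  rewrite mulSn -addnA (le_trans (usub _ _))//.
  by rewrite -natr1 mulrDl mul1r; lra.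
near=> n.
have n0 : (0 < n)%N by near: n; exists 1%N.
have nR0 : 0 < n%:R :> R by rewrite ltr0n.
have low : inf E <= n%:R^-1 * u n.
  apply: ge_inf; first by exists 0.
  by exists n.-1 => //; rewrite prednK.
rewrite ltr_norml; apply/andP; split; last by lra.
have Mn : n%:R^-1 * M < e / 2.
  rewrite mulrC ltr_pdivrMr// mulrC -ltr_pdivrMr//.
  near: n; exact: nbhs_infty_gtr.
have un : n%:R^-1 * u n <= k.+1%:R^-1 * u k.+1 + n%:R^-1 * M.
  rewrite ler_pdivrMl// mulrDr mulVKf ?gt_eqF//.
  rewrite {1}(divn_eq n k.+1) (le_trans (uq _ _ _)) ?ltn_mod// lerD2r.
  rewrite mulrA ler_wpM2r// ler_pdivlMr ?ltr0n//.
  by rewrite -natrM ler_nat leq_trunc_div.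
move: un kE Mn.
move: (inf E) (k.+1%:R^-1 * u k.+1) (n%:R^-1 * M) (n%:R^-1 * u n) => *; lra.
Unshelve. all: by end_near. Qed.

(** * Words of a sequence over a finite alphabet *)

Section words.
Variables (S : finType) (s : nat -> S).

Definition word (n m : nat) : {ffun 'I_n -> S} :=
  [ffun i : 'I_n => s (m + i)%N].

(** Its cardinality is the complexity p(n) of the sequence. *)
Definition words (n : nat) : {set {ffun 'I_n -> S}} :=
  [set v | `[< exists m, word n m = v >]]%SET.

Lemma mem_words n m : word n m \in words n.
Proof. by rewrite finset.inE; apply/asboolP; exists m. Qed.

Lemma wordsP n v : v \in words n -> exists m, word n m = v.
Proof. by rewrite finset.inE => /asboolP. Qed.

Lemma card_words_gt0 n : (0 < #|words n|)%N.
Proof. by rewrite (cardD1 (word n 0)) mem_words. Qed.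

(** Cutting a word into a prefix and a suffix is injective, and both pieces occur in [s]. Hence ln
    p(n) is subadditive. *)
Lemma card_words_mul m n : (#|words (m + n)| <= #|words m| * #|words n|)%N.
Proof.
pose h (v : {ffun 'I_(m + n) -> S}) : {ffun 'I_m -> S} * {ffun 'I_n -> S} :=
  ([ffun i => v (lshift n i)], [ffun i => v (rshift m i)]).
have h_inj : injective h.
  move=> v v' /pair_equal_spec[/ffunP vl /ffunP vr]; apply/ffunP => i.
  rewrite -(fintype.splitK i); case: (fintype.split i) => j /=.
    by have := vl j; rewrite !ffunE.
  by have := vr j; rewrite !ffunE.
rewrite -cardsX -(card_imset _ h_inj); apply/subset_leq_card/fintype.subsetP.
move=> _ /imsetP[v /wordsP[k <-] ->]; rewrite finset.inE.
apply/andP; split=> /=.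
  rewrite (_ : finfun _ = word m k) ?mem_words//.
  by apply/ffunP => i; rewrite !ffunE.
rewrite (_ : finfun _ = word n (k + m)) ?mem_words//.
by apply/ffunP => i; rewrite !ffunE /= addnA.
Qed.

Definition word_position n (v : {ffun 'I_n -> S}) : nat :=
  xget 0 [set m | word n m = v].

Lemma word_positionK n v : v \in words n -> word n (word_position v) = v.
Proof.
by move=> /wordsP[m mv]; rewrite /word_position; case: xgetP => [//|/(_ m)].
Qed.

Lemma word_entropy_cvg (R : realType) :
  exists2 h : R, 0 <= h & (fun n => n%:R^-1 * ln #|words n|%:R) @ \oo --> h.
Proof.
apply: fekete => [n|m n].
  by rewrite ln_ge0// ler1n card_words_gt0.
have wpos k : #|words k|%:R \is @Num.pos R.
  by rewrite posrE ltr0n card_words_gt0.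
rewrite -lnM// ler_ln//; last by rewrite posrE mulr_gt0// -posrE.
by rewrite -natrM ler_nat card_words_mul.
Qed.

End words.

(** * Closeness of points that differ by a rotation *)

Section circle_sequence.
Variables (R : realType) (y : nat -> RmodZ R).
Local Notation X := (set_type (@orbit_closure (RmodZ R) y)).
Implicit Type w : X.

(** This plays the role of a distance on the orbit closure: a small [e] and a large [N] make [w']
    close to [w]. *)
Definition rotated_upto (N : nat) (e : R) w w' :=
  forall i, (i <= N)%N -> orbit_coord i w' = circle_rot e (orbit_coord i w).

Lemma nbhs_rotation w (A : set X) : nbhs w A ->
  \forall w1 \near w & N \near \oo, forall w' (e : R), `|e| < N.+1%:R^-1 ->
    rotated_upto N e w1 w' -> A w'.
Proof.
(* The sets with the required property form a filter, so its convergence to [w] can be checked one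
   coordinate at a time, by continuity of rotation at angle 0. *)
pose G : set_system X := [set B : set X | \forall w1 \near w & N \near \oo,
  forall w' (e : R), `|e| < N.+1%:R^-1 ->
    rotated_upto N e w1 w' -> B w'].
pose Fp := filter_prod (nbhs w) \oo.
have FG : Filter G.
  split; first by apply: (@filterE _ Fp) => -[w1 N].
    move=> B C GB GC; apply: (@filterS2 _ Fp _ _ _ _ _ GB GC).
    move=> -[w1 N] /= B1 C1 w' e eN w'w1.
    by split; [exact: B1 w'w1|exact: C1 w'w1].
  move=> B C BC GB; apply: (@filterS _ Fp _ _ _ _ GB).
  move=> -[w1 N] /= B1 w' e eN w'w1.
  by apply: BC; exact: B1 w'w1.
suff Gw : G --> w by move=> /Gw.
apply: cvg_coord => n B.
rewrite -[X in nbhs X](circle_rot0 (orbit_coord n w)) =>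
  /circle_rot_continuous2[[P Q] /= [wP Q0] PQB].
have [r r0 rQ] : exists2 r : R, 0 < r & forall e, `|e| < r -> Q e.
  have [r /= r0 rQ] := Q0; exists r => // e er.
  by apply: rQ => /=; rewrite sub0r normrN.
exists (orbit_coord n @^-1` P, [set N | (n <= N)%N /\ N.+1%:R^-1 < r]) => /=.
  split; first exact: orbit_coord_continuous.
  near=> N; split; near: N; first exact: nbhs_infty_ge.
  exact: near_infty_natSinv_lt (PosNum r0).
move=> [w1 N] /= [Pw1 [nN Nr]] w' e eN w'w1 /=.
have PQ : (P `*` Q) (@orbit_coord _ y n w1, e).
  by split => //=; apply: rQ; exact: lt_trans Nr.
by rewrite /preimage /= (w'w1 _ nN); exact: (PQB _ PQ).
Unshelve. all: by end_near. Qed.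

(** An analogue of the Lebesgue number: compactness makes the [N] of [nbhs_rotation] uniform in
    [w]. *)
Lemma open_cover_rotation (U : set (set X)) : open_cover U ->
  exists N : nat, forall w, exists2 A, U A & forall w' (e : R),
    `|e| < N.+1%:R^-1 ->
    rotated_upto N e w w' -> A w'.
Proof.
move=> [oU covU].
have /compact_near_coveringP := @orbit_closure_compact _ y (@RmodZ_compact R).
pose P (N : nat) w := exists2 A, U A & forall w' (e : R),
    `|e| < N.+1%:R^-1 ->
    rotated_upto N e w w' -> A w'.
move=> /(_ nat \oo P _) [].
  move=> w _; have [A UA Aw] : (\bigcup_(A in U) A) w by rewrite covU.
  have /nbhs_rotation : nbhs w A.
    by apply: open_nbhs_nbhs; split => //; exact: oU.
  by apply: filterS => -[w1 N] /= AN; exists A.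
by move=> N _ /(_ N (leqnn N)) PN; exists N => w; exact: PN.
Qed.

Lemma rotated_coord_closed n (e : R) :
  closed [set w : X | orbit_coord n w = circle_rot e (orbit_coord 0 w)].
Proof.
apply: closed_eq_fun.
- exact: RmodZ_hausdorff.
- exact: orbit_coord_continuous.
- move=> w; apply: continuous_comp; first exact: orbit_coord_continuous.
  exact: circle_rot_continuous.
Qed.

End circle_sequence.

(** * The sequence a(n) x: words followed by points of the orbit closure, and the upper bound *)

Section linear_phase.
Variables (R : realType) (a : nat -> int) (S : finType) (s : nat -> S).
Variables (d : S -> int) (x : R).
Hypothesis d_inj : injective d.
Hypothesis a_step : forall n, a n.+1 - a n = d (s n).

Let y (n : nat) : RmodZ R := mod1 ((a n)%:~R * x).
Local Notation X := (set_type (@orbit_closure (RmodZ R) y)).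
Implicit Types (w : X) (U : set (set X)).

(** The differences of [a] telescope over the letters of the word. *)
Lemma eq_word n m m' : word s n m = word s n m' ->
  forall i, (i <= n)%N -> a (m + i) - a m = a (m' + i) - a m'.
Proof.
move=> /ffunP mm'; elim=> [|i IH] ltin; first by rewrite !addn0 !subrr.
have := mm' (Ordinal ltin); rewrite !ffunE /= => /(congr1 d).
by rewrite -!a_step !addnS; have := IH (ltnW ltin); lia.
Qed.

(** Points that move as the orbit does from time [m] on. The index is a position, but by
    [follows_word] only the word of length [n] found there matters. *)
Definition follows n m : set X :=
  [set w | forall i, (i <= n)%N ->
    orbit_coord i w = circle_rot ((a (m + i) - a m)%:~R * x) (orbit_coord 0 w)].

Lemma follows_closed n m : closed (follows n m).
Proof.
have -> : follows n m = \bigcap_(i in [set i | (i <= n)%N])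
    [set w : X | orbit_coord i w =
      circle_rot ((a (m + i) - a m)%:~R * x) (orbit_coord 0 w)].
  by [].
by apply: closed_bigI => i _; exact: rotated_coord_closed.
Qed.

Lemma follows_word n m m' : word s n m = word s n m' ->
  follows n m = follows n m'.
Proof.
move=> mm'; apply/seteqP; split=> w fw i lein; rewrite fw//.
  by rewrite (eq_word mm').
by rewrite (eq_word mm').
Qed.

Lemma follows_orbit_point n m : follows n m (orbit_point y m).
Proof.
move=> i _; rewrite !orbit_coord_orbit_point addn0 /y circle_rot_mod1.
by rewrite -mulrDl -intrD subrKC.
Qed.

(** Every orbit point follows its own word, and a union of finitely many closed sets that contains
    the orbit is everything. *)
Lemma follows_exists n w :
  exists2 v, v \in words s n & follows n (word_position s v) w.
Proof.
pose F (v : {ffun 'I_n -> S}) := follows n (word_position s v).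
pose A := \bigcup_(v in [set v | v \in words s n]) F v.
have cA : closed A.
  apply: closed_bigcup => [|v _]; first exact: finite_finset.
  exact: follows_closed.
have AT : A = [set: X].
  apply: orbit_point_dense => // m; exists (word s n m); first exact: mem_words.
  rewrite /F (@follows_word _ _ m) ?word_positionK ?mem_words//.
  exact: follows_orbit_point.
have [v wv Fv] : A w by rewrite AT.
by exists v.
Qed.

(** Points following a common word keep their initial difference, so those that also start in a
    common short arc can be put in the same set of [U] at each of the [n] times. *)
Lemma min_card_cover_iter_le U : open_cover U ->
  exists2 C : nat, (0 < C)%N & forall n,
  (min_card_subcover R (cover_iter (@shift_on_orbit_closure _ y) U n)
    <= (C * #|words s n|)%:R%:E)%E.
Proof.
move=> /open_cover_rotation[N UN].
exists (#|words s N| * N.+2)%N; first by rewrite muln_gt0 card_words_gt0.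
(* The words have length [n + N] because coordinates up to [k + N] are compared for each [k < n].
   The [N.+2] arcs have length 1/(N + 2), below the bound 1/(N + 1) on the angle. *)
move=> n; pose I : finType := ({v | v \in words s (n + N)} * 'I_N.+2)%type.
pose cell (i : I) := [set w | follows (n + N) (word_position s (val i.1)) w /\
  exists2 t : R, (i.2 : nat)%:R <= N.+2%:R * t < (i.2.+1)%:R &
    orbit_coord 0 w = mod1 t].
have cellP w : exists i, cell i w.
  have [v vw fw] := follows_exists (n + N) w.
  have [t /andP[t0 t1] wt] := mod1_lift01 (orbit_coord 0 w).
  have tN0 : 0 <= N.+2%:R * t by rewrite mulr_ge0.
  have /andP[jt tj] := Num.Theory.truncn_itv tN0.
  have jN : (Num.truncn (N.+2%:R * t)  < N.+2)%N.
    rewrite -(ltr_nat R) (le_lt_trans jt)// -[ltRHS]mulr1 ltr_pM2l//.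
  exists (exist _ v vw, Ordinal jN); split => //=.
  by exists t => //; apply/andP.
have cellB i : exists B,
    cover_iter (@shift_on_orbit_closure _ y) U n B /\ cell i `<=` B.
  (* A point [w] of the cell serves as reference; for an empty cell the inclusion is vacuous and any
     point will do. *)
  have [w wi] : exists w, cell i !=set0 -> cell i w.
    have [[w iw]|i0] := pselect (cell i !=set0); first by exists w.
    by exists (orbit_point y 0).
  pose f := @shift_on_orbit_closure _ y.
  have /choice[A AP] : forall k, exists A, U A /\ forall w' (e : R),
      `|e| < N.+1%:R^-1 ->
      rotated_upto N e (iter k f w) w' -> A w'.
    by move=> k; have [A UA Aw] := UN (iter k f w); exists A.
  have [B UB BA] := cover_iter_sup f n (fun k => (AP k).1).
  exists B; split=> // w' iw'; apply: BA => k kn.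
  have [fw [t t_itv wt]] : cell i w by apply: wi; exists w'.
  have [fw' [t' t'_itv wt']] := iw'.
  (* The angle [t' - t] is the same for all times [k]. *)
  apply: (AP k).2 (t' - t) _ _ => [|j jN].
    move: t_itv t'_itv => /andP[t1 t2] /andP[t1' t2'].
    have tt : `|N.+2%:R * (t' - t)| < 1 :> R.
      by rewrite mulrBr; move: t2 t2'; rewrite -natr1 ltr_norml; lra.
    rewrite -(ltr_pM2l (ltr0Sn R N)) mulfV// (le_lt_trans _ tt)//.
    by rewrite normrM ler_wpM2r// ger0_norm// ler_nat.
  have jk : (j + k <= n + N)%N by rewrite addnC leq_add// ltnW.
  rewrite 2!orbit_coord_iter_shift.
  rewrite (fw' _ jk).
  rewrite (fw _ jk).
  rewrite wt wt'.
  by rewrite !circle_rot_mod1; congr mod1; ring.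
have /choice[g gP] := cellB.
apply: (le_trans (min_card_subcover_le R (g := g) _ _)).
- by move=> i; have [] := gP i.
- by move=> w; have [i iw] := cellP w; exists i; exact: (gP i).2.
rewrite lee_fin ler_nat card_prod card_ord card_sig.
rewrite (leq_trans (leq_mul (card_words_mul s n N) (leqnn _)))//.
by rewrite -mulnA mulnC.
Qed.

(** * Lower bound: the clopen partition by first steps *)

Hypothesis x_irrational : forall k : int, k%:~R * x \is a Num.int -> k = 0.

Definition step_cell (k : S) : set X :=
  [set w | orbit_coord 1 w = circle_rot ((d k)%:~R * x) (orbit_coord 0 w)].

(** Irrationality enters here: if two of these rotations agree at a point, the difference of their
    integers times [x] is an integer. *)
Lemma step_cell_inj k k' w : step_cell k w -> step_cell k' w -> k = k'.
Proof.
rewrite /step_cell /= => -> /circle_rot_eqP.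
rewrite -mulrBl -intrB => /x_irrational.
by move=> /eqP; rewrite subr_eq0 => /eqP/d_inj.
Qed.

Lemma step_cell_exists w : exists k, step_cell k w.
Proof.
have [v _ /(_ 1%N (leqnn _))] := follows_exists 1 w.
by rewrite addn1 a_step => wv; eexists; exact: wv.
Qed.

(** The cells are closed, disjoint and finite in number, so the complement of each is a finite union
    of closed sets. *)
Lemma step_cell_open_cover : open_cover (range step_cell).
Proof.
split=> [_ [k _ <-]|]; last first.
  apply/seteqP; split=> // w _; have [k wk] := step_cell_exists w.
  by exists (step_cell k) => //; exists k.
rewrite -[step_cell k]setCK; apply: closed_openC.
have -> : ~` step_cell k = \bigcup_(j in [set j | j != k]) step_cell j.
  apply/seteqP; split=> [w wk|w [j jk wj] wk].
    have [j wj] := step_cell_exists w; exists j => //=.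
    by apply/eqP => jk; apply: wk; rewrite -jk.
  by move: jk; rewrite (step_cell_inj wj wk)/= eqxx.
apply: closed_bigcup => [|j _]; first exact: finite_finset.
exact: rotated_coord_closed.
Qed.

(** At time [i] the orbit point starting at [m] lies only in the cell of the letter [s (m + i)]. A
    member of the join thus determines the word of length [n] of each orbit point in it. *)
Lemma min_card_step_cells_ge n :
  (#|words s n|%:R%:E <= min_card_subcover R
    (cover_iter (@shift_on_orbit_closure _ y) (range step_cell) n))%E.
Proof.
pose o (v : {v | v \in words s n}) := orbit_point y (word_position s (val v)).
have step m i k :
    step_cell k (iter i (@shift_on_orbit_closure _ y) (orbit_point y m)) ->
    s (m + i) = k.
  apply: step_cell_inj; rewrite /step_cell /= !orbit_coord_iter_shift.
  rewrite !orbit_coord_orbit_point /y circle_rot_mod1 -a_step -mulrDl -intrD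
    add0n add1n addnS.
  by rewrite subrKC.
have := min_card_subcover_ge R (o := o)
  (V := cover_iter (@shift_on_orbit_closure _ y) (range step_cell) n).
rewrite card_sig; apply=> B v v' UB Bv Bv'; apply: val_inj.
rewrite -(word_positionK (valP v)) -(word_positionK (valP v')).
apply/ffunP => i; rewrite !ffunE.
have [_ [k _ <-] Bk] := cover_iter_sub UB (ltn_ord i).
by rewrite (step _ _ _ (Bk _ Bv)) (step _ _ _ (Bk _ Bv')).
Qed.

(** * The entropy as the growth rate of the number of words *)

Lemma AE_linear_phase (h : R) : 0 <= h ->
  (fun n => n%:R^-1 * ln #|words s n|%:R) @ \oo --> h -> AE R y = h%:E.
Proof.
move=> h0 hcvg.
have cvgE (v : nat -> R) : v @ \oo --> h -> (v n)%:E @[n --> \oo] --> h%:E.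
  by move=> vh; apply/fine_cvgP; split => //; exact: nearW.
have wpos n : 0 < #|words s n|%:R :> R by rewrite ltr0n card_words_gt0.
(* The constant [C] of the upper bound contributes (ln C)/n, which tends to 0. *)
have upper U : open_cover U -> exists2 v : nat -> R, v @ \oo --> h &
    forall n, (n%:R^-1%:E * lne (min_card_subcover R
      (cover_iter (@shift_on_orbit_closure _ y) U n)) <= (v n)%:E)%E.
  move=> /min_card_cover_iter_le[C C0 CU].
  exists (fun n => n%:R^-1 * ln C%:R + n%:R^-1 * ln #|words s n|%:R).
    rewrite -[X in _ --> X]add0r -[X in X + _](mul0r (ln C%:R)).
    apply: cvgD => //; apply: cvgM; last exact: cvg_cst.
    by rewrite -cvg_shiftS; exact: cvg_harmonic.
  move=> n; rewrite -mulrDr -lnM ?posrE ?wpos ?ltr0n// EFinM.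
  rewrite lee_wpmul2l ?lee_fin ?invr_ge0//.
  rewrite -lne_EFin; last by rewrite mulr_gt0 ?wpos ?ltr0n.
  rewrite lee_lne -?natrM ?CU//; last first.
    by rewrite in_itv/= leey lee_fin ler0n.
  rewrite in_itv/= leey andbT; apply: le_ereal_inf_tmp => _ [k _ <-].
  by rewrite lee_fin.
apply/eqP; rewrite eq_le; apply/andP; split.
  apply: ge_ereal_sup => _ [U oU <-].
  have [v vh Uv] := upper U oU; rewrite /cover_entropy.
  set u := (X in limn X).
  have [cu|ncu] := pselect (cvgn u); last first.
    (* the limit of a divergent sequence is the default value 0 *)
    by rewrite (dvgP ncu) -[point]/(0%E) lee_fin.
  have vh' : (v n)%:E @[n --> \oo] --> h%:E by exact: cvgE.
  rewrite -(cvg_lim _ vh')//; apply: lee_lim => //.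
    by apply/cvg_ex; exists h%:E.
  exact: nearW.
apply: ereal_sup_ubound; exists (range step_cell).
  exact: step_cell_open_cover.
(* The upper bound applies to the cover by cells as well, so its entropy is squeezed to exactly
   [h]. *)
have [v vh Uv] := upper _ step_cell_open_cover.
apply/cvg_lim => //.
apply: squeeze_cvge; last 2 first.
- exact: cvgE hcvg.
- exact: cvgE vh.
apply: nearW => n; rewrite Uv andbT EFinM lee_wpmul2l ?lee_fin ?invr_ge0//.
rewrite -lne_EFin// lee_lne ?min_card_step_cells_ge//.
  by rewrite in_itv/= leey lee_fin ler0n.
rewrite in_itv/= leey andbT.
by rewrite (le_trans _ (min_card_step_cells_ge n))// lee_fin.
Qed.

End linear_phase.

(** * Almost every x is irrational, and the conclusion *)

Lemma ae_irrational (R : realType) :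
  {ae (@lebesgue_measure R), forall x : R,
    forall k : int, k%:~R * x \is a Num.int -> k = 0}.
Proof.
pose Q := range (fun q : rat => ratr q : R).
have cQ : countable Q.
  by apply: (card_le_trans (card_image_le _ _)); exact: countableP.
exists Q; split.
- exact: countable_measurable.
- exact: countable_lebesgue_measure0.
(* A nonzero [k] with k x = j makes x the rational j/k. *)
move=> x /= /existsNP[k /not_implyP[/intrP[j kxj] /eqP k0]].
exists (j%:~R / k%:~R) => //.
rewrite fmorph_div /= !ratr_int -kxj mulrC mulKf//.
by rewrite intr_eq0.
Qed.

Theorem theorem1p3 (R : realType) (a : nat -> int)
    (ha : exists C : int, forall n : nat, `|a n.+1 - a n| <= C) :
  exists lambda : \bar R, (0 <= lambda)%E /\
    {ae (@lebesgue_measure R), forall x : R,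
      AE R (fun n : nat => mod1 ((a n)%:~R * x)) = lambda}.
Proof.
have [C aC] := ha.
have C0 : 0 <= C by apply: le_trans (aC 0%N).
pose c := `|C|%N.
(* The differences lie between -c and c; shifted by [c] they become letters 0, ..., 2c. *)
pose d (k : 'I_(2 * c).+1) : int := (k : nat)%:Z - c%:Z.
pose s n : 'I_(2 * c).+1 := inord (absz (a n.+1 - a n + c%:Z)).
have d_inj : injective d.
  by move=> k k'; rewrite /d => kk'; apply: val_inj => /=; lia.
have a_step n : a n.+1 - a n = d (s n).
  have := aC n; have cE : c%:Z = C by rewrite gez0_abs.
  by rewrite ler_norml -cE => /andP[? ?]; rewrite /d /s inordK; lia.
have [h h0 hcvg] := word_entropy_cvg s R.
exists h%:E; split; first by rewrite lee_fin.
apply: negligibleS (ae_irrational R) => x; apply: contra_not => x_irr.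
exact: (AE_linear_phase d_inj a_step x_irr h0 hcvg).
Qed.
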